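(* Let $G=(V,E)$ be the Cayley graph of the Grigorchuk group with generator set $\{a,b,c\}$. Then: (a) $G$ admits no graph height function; (b) for every normal subgroup $\mathcal H$ of $\mathrm{Aut}(G)$ with finite index, any $\mathcal H$-difference-invariant function on $V$ is constant on each orbit of $\mathcal H$.
   Context: The Grigorchuk group: let $T$ be the rooted infinite binary tree, whose vertices are identified with the finite strings with entries in $\{0,1\}$, the root being the empty string. Let $T_0$, $T_1$ be the subtrees of all vertices whose strings begin with $0$, respectively $1$; each is naturally identified with $T$. Let $\mathrm{Aut}(T)$ be the automorphism group of the rooted tree $T$. Let $a\in\mathrm{Aut}(T)$ be the automorphism that, for each string $u$, interchanges the vertices $0u$ and $1u$. For $\gamma_0,\gamma_1\in\mathrm{Aut}(T)$, let $(\gamma_0,\gamma_1)\in\mathrm{Aut}(T)$ be the automorphism obtained by applying $\gamma_0$ to $T_0$ and $\gamma_1$ to $T_1$. Automorphisms $b,c,d$ are defined recursively by $b=(a,c)$, $c=(a,d)$, $d=(e,b)$, where $e$ is the identity automorphism. The Grigorchuk group is the subgroup of $\mathrm{Aut}(T)$ generated by $\{a,b,c\}$ (the elements $a,b,c$ are involutions). Cayley graphs: for a group $\Gamma$ with identity $\mathbf 1$ and a finite generating set $S$ with $S^{-1}=S$ and $\mathbf 1\notin S$, the Cayley graph is the simple graph with vertex-set $V=\Gamma$ and an undirected edge $\langle\gamma_1,\gamma_2\rangle$ if and only if $\gamma_2=\gamma_1 s$ for some $s\in S$. Graph height functions: let $G=(V,E)$ be an infinite, locally finite, connected, vertex-transitive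 simple graph with a distinguished vertex $\mathbf 1$ (the identity in the case of a Cayley graph), and let $\partial v$ denote the set of neighbours of $v$. For $\mathcal H\le\mathrm{Aut}(G)$, a function $F:V\to\mathbb R$ is $\mathcal H$-difference-invariant if $F(v)-F(w)=F(\gamma v)-F(\gamma w)$ for all $v,w\in V$ and $\gamma\in\mathcal H$. A subgroup of $\mathrm{Aut}(G)$ acts quasi-transitively if it has finitely many orbits on $V$. A graph height function on $G$ is a pair $(h,\mathcal H)$ where $\mathcal H\le\mathrm{Aut}(G)$ acts quasi-transitively on $G$ and $h:V\to\mathbb Z$ satisfies: (i) $h(\mathbf 1)=0$; (ii) $h$ is $\mathcal H$-difference-invariant; (iii) for every $v\in V$ there exist $u,w\in\partial v$ with $h(u)<h(v)<h(w)$. *)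

(* Defs.v *)
From HB Require Import structures.
From mathcomp Require Import all_boot all_order all_algebra.
From mathcomp Require Import boolp classical_sets functions cardinality reals.

Set Implicit Arguments.
Unset Strict Implicit.
Unset Printing Implicit Defensive.

Import Order.TTheory GRing.Theory Num.Theory.

Local Open Scope classical_set_scope.
Local Open Scope group_scope.

(* Subgroups of a [groupType] are the elements of MathComp's [groupClosed]
   structure; [subgroup_type H] is such a subgroup seen as a group. *)

Definition subgroup_type (G : groupType) (H : groupClosed G) : Type :=
  {x : G | x \in H}.

Section SubgroupType.
Variables (G : groupType) (H : groupClosed G).

HB.instance Definition _ := SubChoice.on (subgroup_type H).

Fact subgroup_type_closed : group_closed (fun x => x \in H).
Proof. by split=> [|x y Hx Hy]; [exact: gpred1 | exact: gpredF]. Qed.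

HB.instance Definition _ := SubChoice_isSubGroup.Build
  G (fun x => x \in H) (subgroup_type H) subgroup_type_closed.

Lemma subgroup_val1 : \val (1 : subgroup_type H) = 1.
Proof. exact: gmulf1. Qed.
Lemma subgroup_valM (x y : subgroup_type H) : \val (x * y) = \val x * \val y.
Proof. exact: gmulfM. Qed.
Lemma subgroup_valV (x : subgroup_type H) : \val x^-1 = (\val x)^-1.
Proof. exact: gmulfV. Qed.

End SubgroupType.

Definition generated_subgroup (G : groupType) (A : set G) : {pred G} :=
  fun x => `[< forall H : groupClosed G, (forall y, A y -> y \in H) -> x \in H >].

Section Generated.
Variables (G : groupType) (A : set G).

Lemma generatedP x : reflect
  (forall H : groupClosed G, (forall y, A y -> y \in H) -> x \in H)
  (x \in generated_subgroup A).
Proof. exact: asboolP. Qed.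

Lemma mem_generated x : A x -> x \in generated_subgroup A.
Proof. by move=> Ax; apply/generatedP => H; apply. Qed.

Fact generated_mul : mulg_closed (generated_subgroup A).
Proof.
move=> x y /generatedP xA /generatedP yA; apply/generatedP => H AH.
by apply: gpredM; [exact: xA | exact: yA].
Qed.
Fact generated_one : 1 \in generated_subgroup A.
Proof. by apply/generatedP => H _; exact: gpred1. Qed.
Fact generated_inv : invg_closed (generated_subgroup A).
Proof.
move=> x /generatedP xA; apply/generatedP => H AH.
by rewrite gpredV; exact: xA.
Qed.

HB.instance Definition _ := isMulClosed.Build G (generated_subgroup A) generated_mul.
HB.instance Definition _ := isMul1Closed.Build G (generated_subgroup A) generated_one.
HB.instance Definition _ := isInvClosed.Build G (generated_subgroup A) generated_inv.

End Generated.

Definition normal_subgroup (G : groupType) (H : groupClosed G) : Prop :=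
  forall g x : G, x \in H -> g * x * g^-1 \in H.

Definition left_coset (G : groupType) (H : groupClosed G) (g : G) : set G :=
  [set x | exists2 h, h \in H & x = g * h].

Definition finite_index (G : groupType) (H : groupClosed G) : Prop :=
  finite_set (range (left_coset H)).

Record sgraph := SGraph {
  vertex :> Type;
  adj : vertex -> vertex -> Prop;
  adj_sym : forall u v, adj u v -> adj v u;
  adj_irr : forall v, ~ adj v v
}.

Record gaut (G : sgraph) := GAut {
  gaut_fun :> G -> G;
  gaut_bij : bijective gaut_fun;
  gaut_adj : forall u v, adj (gaut_fun u) (gaut_fun v) <-> adj u v
}.

Lemma gautP (G : sgraph) (f g : gaut G) : f =1 g -> f = g.
Proof.
case: f g => [f fb fa] [g gb ga] /= /funext fg; subst g.
by congr GAut; exact: Prop_irrelevance.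
Qed.

(* The group law is composition of maps, [(f * g) v = f (g v)]: automorphisms
   act on the left. *)
Section GAutGroup.
Variable G : sgraph.
Implicit Types f g : gaut G.

Definition gaut_id : gaut G :=
  @GAut G id (Bijective (fun=> erefl) (fun=> erefl)) (fun u v => iff_refl _).

Fact gaut_comp_adj f g u v : adj ((f \o g) u) ((f \o g) v) <-> adj u v.
Proof. exact: iff_trans (gaut_adj f _ _) (gaut_adj g u v). Qed.
Definition gaut_comp f g : gaut G :=
  GAut (bij_comp (gaut_bij f) (gaut_bij g)) (gaut_comp_adj f g).

Fact gaut_inv_subproof f : {g : gaut G | cancel f g /\ cancel g f}.
Proof.
apply: cid; have [g fK gK] := gaut_bij f.
have ga u v : adj (g u) (g v) <-> adj u v.
  by rewrite -[in X in _ <-> X](gK u) -[in X in _ <-> X](gK v) gaut_adj.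
by exists (GAut (Bijective gK fK) ga).
Qed.
Definition gaut_inv f : gaut G := sval (gaut_inv_subproof f).
Lemma gaut_invK f : cancel f (gaut_inv f).
Proof. exact: (svalP (gaut_inv_subproof f)).1. Qed.
Lemma gaut_Kinv f : cancel (gaut_inv f) f.
Proof. exact: (svalP (gaut_inv_subproof f)).2. Qed.

Fact gaut_compA : associative gaut_comp.
Proof. by move=> f g h; exact: gautP. Qed.
Fact gaut_comp1g : left_id gaut_id gaut_comp.
Proof. by move=> f; exact: gautP. Qed.
Fact gaut_compg1 : right_id gaut_id gaut_comp.
Proof. by move=> f; exact: gautP. Qed.
Fact gaut_compVg : left_inverse gaut_id gaut_inv gaut_comp.
Proof. by move=> f; apply: gautP => v /=; exact: gaut_invK. Qed.
Fact gaut_compgV : right_inverse gaut_id gaut_inv gaut_comp.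
Proof. by move=> f; apply: gautP => v /=; exact: gaut_Kinv. Qed.

HB.instance Definition _ := gen_eqMixin (gaut G).
HB.instance Definition _ := gen_choiceMixin (gaut G).
HB.instance Definition _ := isGroup.Build (gaut G)
  gaut_compA gaut_comp1g gaut_compg1 gaut_compVg gaut_compgV.

Definition aut_orbit (H : groupClosed (gaut G)) (v : G) : set G :=
  [set w | exists2 g, g \in H & w = g v].

Definition quasi_transitive (H : groupClosed (gaut G)) : Prop :=
  finite_set (range (aut_orbit H)).

(* Stated over an arbitrary abelian group, so as to cover integer-valued as
   well as real-valued functions. *)
Definition difference_invariant (W : zmodType) (H : groupClosed (gaut G))
    (F : G -> W) : Prop :=
  forall (g : gaut G) (v w : G), g \in H -> (F v - F w = F (g v) - F (g w))%R.

(* [v1] is the distinguished vertex. *)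
Definition graph_height_function (v1 : G) (h : G -> int)
    (H : groupClosed (gaut G)) : Prop :=
  [/\ quasi_transitive H,
      h v1 = 0%R,
      difference_invariant H h
    & forall v, exists u w, [/\ adj v u, adj v w & (h u < h v < h w)%R]].

Definition stabiliser (v : G) : {pred gaut G} := fun f => `[< f v = v >].

Lemma stabiliserP v f : reflect (f v = v) (f \in stabiliser v).
Proof. exact: asboolP. Qed.

Section Stabiliser.
Variable v : G.
Fact stabiliser_mul : mulg_closed (stabiliser v).
Proof.
move=> f g /stabiliserP fv /stabiliserP gv.
by apply/stabiliserP; rewrite /= gv fv.
Qed.
Fact stabiliser_one : 1 \in stabiliser v.
Proof. exact/stabiliserP. Qed.
Fact stabiliser_inv : invg_closed (stabiliser v).
Proof.
move=> f /stabiliserP fv; apply/stabiliserP.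
by rewrite -[in LHS]fv; exact: gaut_invK.
Qed.
HB.instance Definition _ := isMulClosed.Build _ (stabiliser v) stabiliser_mul.
HB.instance Definition _ := isMul1Closed.Build _ (stabiliser v) stabiliser_one.
HB.instance Definition _ := isInvClosed.Build _ (stabiliser v) stabiliser_inv.
End Stabiliser.

End GAutGroup.

Record cayley_set (Gamma : groupType) := CayleySet {
  cayley_carrier : set Gamma;
  cayley_finite : finite_set cayley_carrier;
  cayley_generates : forall x, x \in generated_subgroup cayley_carrier;
  cayley_inv : forall s, cayley_carrier s -> cayley_carrier s^-1;
  cayley_one : ~ cayley_carrier 1
}.

Section CayleyGraph.
Variables (Gamma : groupType) (S : cayley_set Gamma).

Definition cayley_adj (x y : Gamma) : Prop :=
  exists2 s, cayley_carrier S s & y = x * s.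

Fact cayley_adj_sym x y : cayley_adj x y -> cayley_adj y x.
Proof.
by case=> s Ss ->; exists s^-1; [exact: cayley_inv | rewrite mulgK].
Qed.
Fact cayley_adj_irr x : ~ cayley_adj x x.
Proof.
case=> s Ss xs; apply: (@cayley_one _ S).
by have -> : 1 = s by apply: (@mulgI _ x); rewrite mulg1.
Qed.

Definition cayley_graph : sgraph := SGraph cayley_adj_sym cayley_adj_irr.

Definition cayley_id : cayley_graph := (1 : Gamma).

End CayleyGraph.

(* In the tree, [false] and [true] are the letters 0 and 1; the parent of a
   non-empty string is obtained by deleting its last letter. *)
Definition tree_adj (u v : seq bool) : Prop :=
  exists x, v = rcons u x \/ u = rcons v x.

Fact tree_adj_sym u v : tree_adj u v -> tree_adj v u.
Proof. by case=> x [|] ->; exists x; [right | left]. Qed.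
Fact tree_adj_irr u : ~ tree_adj u u.
Proof. by case=> x [|] /(congr1 size); rewrite size_rcons => /n_Sn. Qed.

Definition bintree : sgraph := SGraph tree_adj_sym tree_adj_irr.

Definition tree_root : bintree := [::].

Definition autT : groupType := subgroup_type (stabiliser tree_root).

Definition autT_fun (g : autT) : seq bool -> seq bool := val g.

Lemma autT_bij (g : autT) : bijective (autT_fun g).
Proof. exact: (gaut_bij (val g)). Qed.

Lemma autT_adj (g : autT) u v :
  tree_adj (autT_fun g u) (autT_fun g v) <-> tree_adj u v.
Proof. exact: (gaut_adj (val g)). Qed.

Lemma autT_root (g : autT) : autT_fun g [::] = [::].
Proof. exact: (elimT (stabiliserP _ _) (valP g)). Qed.

Lemma autTP (f g : autT) : autT_fun f =1 autT_fun g -> f = g.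
Proof. by move=> fg; apply/val_inj/gautP. Qed.

Definition mk_autT (f : seq bool -> seq bool) (fb : bijective f)
    (fa : forall u v, tree_adj (f u) (f v) <-> tree_adj u v)
    (f0 : f [::] = [::]) : autT :=
  @exist _ (fun x => x \in stabiliser tree_root) (@GAut bintree f fb fa) (asboolT f0).

Section PairAutT.
Variables g0 g1 : autT.

Definition pair_fun (h0 h1 : seq bool -> seq bool) (u : seq bool) : seq bool :=
  match u with
  | [::] => [::]
  | false :: v => false :: h0 v
  | true :: v => true :: h1 v
  end.

Fact pair_fun_bij : bijective (pair_fun (autT_fun g0) (autT_fun g1)).
Proof.
have [h0 g0K h0K] := autT_bij g0; have [h1 g1K h1K] := autT_bij g1.
by exists (pair_fun h0 h1) => -[|[] u] //=; congr (_ :: _).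
Qed.

Fact tree_adj_cons x y u v :
  tree_adj (x :: u) (y :: v) <-> x = y /\ tree_adj u v.
Proof.
split=> [[z [|] []] -> -> | [-> [z [|] ->]]]; last first.
- by exists z; right.
- by exists z; left.
- by split=> //; exists z; right.
- by split=> //; exists z; left.
Qed.

Fact tree_adj_nil y v : tree_adj [::] (y :: v) <-> v = [::].
Proof. by split=> [[z [[]|]]// | ->]; exists y; left. Qed.

Fact pair_fun_adj u v :
  tree_adj (pair_fun (autT_fun g0) (autT_fun g1) u)
           (pair_fun (autT_fun g0) (autT_fun g1) v) <-> tree_adj u v.
Proof.
have nilE (g : autT) w : (autT_fun g w = [::]) <-> (w = [::]).
  split=> [|->]; last exact: autT_root.
  by rewrite -{1}(autT_root g) => /(bij_inj (autT_bij g)).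
have symE w w' : tree_adj w w' <-> tree_adj w' w by split; exact: tree_adj_sym.
case: u v => [|x u] [|y v] //.
- by case: y; rewrite /= !tree_adj_nil nilE.
- by case: x; rewrite /= symE tree_adj_nil nilE symE tree_adj_nil.
- by case: x y => [] [] /=; rewrite !tree_adj_cons ?autT_adj //; split=> -[].
Qed.

(* (g0, g1) : apply g0 to the subtree below 0 and g1 to the subtree below 1. *)
Definition pair_autT : autT := mk_autT pair_fun_bij pair_fun_adj erefl.

End PairAutT.

Section Involution.
Variable f : seq bool -> seq bool.
Hypothesis fK : involutive f.
Hypothesis f_rcons : forall u x, exists y, f (rcons u x) = rcons (f u) y.

Fact involution_adj u v : tree_adj (f u) (f v) <-> tree_adj u v.
Proof.
have fa w w' : tree_adj w w' -> tree_adj (f w) (f w').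
  by case=> x [|] ->; [have [y ->] := f_rcons w x | have [y ->] := f_rcons w' x];
    exists y; [left|right].
by split=> [/fa|/fa//]; rewrite !fK.
Qed.

End Involution.

Definition a_fun (u : seq bool) : seq bool :=
  if u is x :: v then ~~ x :: v else [::].

(* The recursion b = (a, c), c = (a, d), d = (e, b); the three equations
   between automorphisms are [gri_bE], [gri_cE] and [gri_dE] below. *)
Fixpoint b_fun (u : seq bool) : seq bool :=
  match u with
  | [::] => [::]
  | false :: v => false :: a_fun v
  | true :: v => true :: c_fun v
  end
with c_fun (u : seq bool) : seq bool :=
  match u with
  | [::] => [::]
  | false :: v => false :: a_fun v
  | true :: v => true :: d_fun v
  end
with d_fun (u : seq bool) : seq bool :=
  match u with
  | [::] => [::]
  | false :: v => false :: v
  | true :: v => true :: b_fun v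
  end.

Fact a_funK : involutive a_fun.
Proof. by case=> //= x v; rewrite negbK. Qed.

Fact bcd_funK u : [/\ b_fun (b_fun u) = u, c_fun (c_fun u) = u
  & d_fun (d_fun u) = u].
Proof.
by elim: u => [//|[] u [IHb IHc IHd]] /=; rewrite ?a_funK ?IHb ?IHc ?IHd.
Qed.
Fact b_funK : involutive b_fun. Proof. by move=> u; case: (bcd_funK u). Qed.
Fact c_funK : involutive c_fun. Proof. by move=> u; case: (bcd_funK u). Qed.
Fact d_funK : involutive d_fun. Proof. by move=> u; case: (bcd_funK u). Qed.

Fact a_fun_rcons u x : exists y, a_fun (rcons u x) = rcons (a_fun u) y.
Proof. by case: u => [|z u] /=; [exists (~~ x) | exists x]. Qed.

Fact bcd_fun_rcons u x : [/\ exists y, b_fun (rcons u x) = rcons (b_fun u) y,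
  exists y, c_fun (rcons u x) = rcons (c_fun u) y
  & exists y, d_fun (rcons u x) = rcons (d_fun u) y].
Proof.
elim: u => [|[] u [[yb Eb] [yc Ec] [yd Ed]]].
- by split; exists x; case: x.
- by split; [exists yc; rewrite /= Ec|exists yd; rewrite /= Ed
            |exists yb; rewrite /= Eb].
- have [y Ea] := a_fun_rcons u x.
  by split; [exists y; rewrite /= Ea|exists y; rewrite /= Ea|exists x].
Qed.
Fact b_fun_rcons u x : exists y, b_fun (rcons u x) = rcons (b_fun u) y.
Proof. by case: (bcd_fun_rcons u x). Qed.
Fact c_fun_rcons u x : exists y, c_fun (rcons u x) = rcons (c_fun u) y.
Proof. by case: (bcd_fun_rcons u x). Qed.
Fact d_fun_rcons u x : exists y, d_fun (rcons u x) = rcons (d_fun u) y.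
Proof. by case: (bcd_fun_rcons u x). Qed.

Definition gri_a : autT :=
  mk_autT (inv_bij a_funK) (involution_adj a_funK a_fun_rcons) erefl.
Definition gri_b : autT :=
  mk_autT (inv_bij b_funK) (involution_adj b_funK b_fun_rcons) erefl.
Definition gri_c : autT :=
  mk_autT (inv_bij c_funK) (involution_adj c_funK c_fun_rcons) erefl.
Definition gri_d : autT :=
  mk_autT (inv_bij d_funK) (involution_adj d_funK d_fun_rcons) erefl.

Lemma gri_bE : gri_b = pair_autT gri_a gri_c.
Proof. by apply: autTP => -[|[] u]. Qed.
Lemma gri_cE : gri_c = pair_autT gri_a gri_d.
Proof. by apply: autTP => -[|[] u]. Qed.
Lemma gri_dE : gri_d = pair_autT 1 gri_b.
Proof. by apply: autTP => -[|[] u]. Qed.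

Lemma gri_aV : gri_a^-1 = gri_a.
Proof. by apply: mulg1_eq; apply: autTP => u; exact: a_funK. Qed.
Lemma gri_bV : gri_b^-1 = gri_b.
Proof. by apply: mulg1_eq; apply: autTP => u; exact: b_funK. Qed.
Lemma gri_cV : gri_c^-1 = gri_c.
Proof. by apply: mulg1_eq; apply: autTP => u; exact: c_funK. Qed.

Definition grigorchuk_gens : set autT := [set gri_a] `|` [set gri_b] `|` [set gri_c].

Definition grigorchuk : groupType := subgroup_type (generated_subgroup grigorchuk_gens).

(* The set {a, b, c}, seen inside the group that it generates. *)
Definition grigorchuk_gens_sub : set grigorchuk :=
  [set x | grigorchuk_gens (val x)].

Fact grigorchuk_gens_finite : finite_set grigorchuk_gens_sub.
Proof.
have -> : grigorchuk_gens_sub = val @^-1` grigorchuk_gens by [].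
apply: finite_preimage; first by move=> x y _ _; exact: val_inj.
by rewrite /grigorchuk_gens !finite_setU; do !split; exact: finite_set1.
Qed.

Fact grigorchuk_gens_inv s :
  grigorchuk_gens_sub s -> grigorchuk_gens_sub s^-1.
Proof.
have sV : val s^-1 = (val s)^-1 := subgroup_valV s.
rewrite /grigorchuk_gens_sub /grigorchuk_gens /mkset sV.
by case=> [[]|] ->; rewrite ?gri_aV ?gri_bV ?gri_cV; [left; left|left; right|right].
Qed.

Fact grigorchuk_gens_one : ~ grigorchuk_gens_sub 1.
Proof.
rewrite /grigorchuk_gens_sub /=.
by case=> [[]|] /(congr1 (fun g => autT_fun g [:: false; false])).
Qed.

Fact grigorchuk_gens_generate x : x \in generated_subgroup grigorchuk_gens_sub.
Proof.
apply/generatedP => H SH.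
pose K : {pred autT} := fun y => `[< exists2 z : grigorchuk, z \in H & val z = y >].
have KP y : reflect (exists2 z : grigorchuk, z \in H & val z = y) (y \in K)
  by exact: asboolP.
have KM : mulg_closed K.
  move=> _ _ /KP[y Hy <-] /KP[z Hz <-]; apply/KP.
  by exists (y * z); [exact: gpredM | rewrite subgroup_valM].
have K1 : 1 \in K by apply/KP; exists 1; [exact: gpred1 | rewrite subgroup_val1].
have KV : invg_closed K.
  move=> _ /KP[y Hy <-]; apply/KP.
  by exists y^-1; [rewrite gpredV | rewrite subgroup_valV].
pose mM := isMulClosed.Build _ K KM.
pose m1 := isMul1Closed.Build _ K K1.
pose mV := isInvClosed.Build _ K KV.
pose KG : groupClosed autT := HB.pack K mM m1 mV.
have : val x \in KG.
  apply: (elimT (generatedP _ _) (valP x)) => y Sy; apply/KP.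
  by exists (Sub y (mem_generated Sy)); [apply: SH|]; rewrite ?/grigorchuk_gens_sub /= ?SubK.
by case/KP=> z Hz /val_inj <-.
Qed.

Definition grigorchuk_cayley_set : cayley_set grigorchuk :=
  CayleySet grigorchuk_gens_finite grigorchuk_gens_generate
    grigorchuk_gens_inv grigorchuk_gens_one.

Definition grigorchuk_graph : sgraph := cayley_graph grigorchuk_cayley_set.

(* Main.v *)
Require Import Defs.
From HB Require Import structures.
From mathcomp Require Import all_boot all_order all_algebra.
From mathcomp Require Import boolp classical_sets functions cardinality reals.

Set Implicit Arguments.
Unset Strict Implicit.
Unset Printing Implicit Defensive.

Import Order.TTheory GRing.Theory Num.Theory.

(** Let H be a group of automorphisms of the Cayley graph G of the Grigorchuk
    group, and let F be H-difference-invariant. For f in H the increment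
    F (f v) - F v does not depend on v, so it is multiplied by n when f is
    replaced by f ^+ n. If every automorphism of G has finite order, all these
    increments vanish and F is constant on the orbits of H
    ([difference_invariant_orbit]); this gives (b). In (a) there are finitely
    many orbits, so h takes finitely many values, and a vertex at which h is
    maximal has no neighbour above it.

    That every automorphism has finite order rests on two facts.

    Every automorphism of G is a left translation ([grigorchuk_autE]). The
    relation (bc)^2 = 1 makes the edges labelled b and c into disjoint
    4-cycles, and no closed non-backtracking walk of length 4 uses an edge
    labelled a; so automorphisms preserve the a-edges, and at each vertex they
    either fix or exchange the labels b and c. An exchange is ruled out by the
    relation (ca)^8 = 1: a word y1 a y2 a ... y8 a with all yi in {b, c} that
    starts with b is never trivial, so the closed walk (ca)^8 cannot be sent to
    a walk that starts along b.

    The Grigorchuk group is a torsion group ([grigorchuk_torsion]); the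
    classical argument by contraction is used. Up to conjugation, an element
    outside the four-group {1, b, c, d} is a product
    w = (a x1) ... (a xm) with every xi in {1, b, c, d}, and one inducts on m.
    If m is even, then w = (w0, w1), where w0 and w1 involve fewer than m
    letters a. If m is odd, then w^2 = (w0, w1), where w0 and w1 involve as many
    letters a as there are xi in {b, c}; this is fewer than m when 1 or d occurs
    among the xi. In the remaining case w0 and w1 are again, up to conjugation,
    products of the same form and the same m, in which b is replaced by c and c
    by d, so that after at most two such steps a letter d appears. *)

Local Open Scope classical_set_scope.
Local Open Scope group_scope.

(** * Elements of finite order *)

Definition torsion (G : groupType) (g : G) : Prop :=
  exists2 n, (0 < n)%N & g ^+ n = 1.

Lemma torsion1 (G : groupType) : torsion (1 : G).
Proof. by exists 1%N. Qed.

Lemma torsionX (G : groupType) (g : G) m :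
  (0 < m)%N -> torsion (g ^+ m) -> torsion g.
Proof.
by move=> m0 [n n0 gn]; exists (m * n)%N; rewrite ?muln_gt0 ?m0 // expgnA.
Qed.

Lemma torsionJ (G : groupType) (g h : G) : torsion (g ^ h) <-> torsion g.
Proof.
split=> -[n n0 gn]; exists n => //; last by rewrite -conjXg gn conj1g.
by apply: (@conjg_inj _ h); rewrite conjXg gn conj1g.
Qed.

Lemma torsionC (G : groupType) (g h : G) : torsion (g * h) -> torsion (h * g).
Proof. by move=> gh; apply/(torsionJ _ h); rewrite conjgE -mulgA mulKg. Qed.

(** * Automorphisms of the tree acting on the two subtrees *)

Lemma autTM (f g : autT) u : autT_fun (f * g) u = autT_fun f (autT_fun g u).
Proof. by rewrite /autT_fun subgroup_valM. Qed.

Lemma autT1 u : autT_fun 1 u = u.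
Proof. by rewrite /autT_fun subgroup_val1. Qed.

Lemma pairM f0 f1 g0 g1 :
  pair_autT f0 f1 * pair_autT g0 g1 = pair_autT (f0 * g0) (f1 * g1).
Proof. by apply: autTP => -[|[] u]; rewrite autTM //= /autT_fun /= -!autTM. Qed.

Lemma pair1 : pair_autT 1 1 = 1.
Proof.
by apply: autTP => -[|[] u]; rewrite autT1 //= /autT_fun /= -/(autT_fun _ _) autT1.
Qed.

Lemma pairX f0 f1 n : pair_autT f0 f1 ^+ n = pair_autT (f0 ^+ n) (f1 ^+ n).
Proof. by elim: n => [|n IHn]; rewrite ?pair1 // !expgS IHn pairM. Qed.

Lemma pair_a f0 f1 : pair_autT f0 f1 * gri_a = gri_a * pair_autT f1 f0.
Proof. by apply: autTP => -[|[] u]; rewrite !autTM. Qed.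

Lemma torsion_pair f0 f1 : torsion f0 -> torsion f1 -> torsion (pair_autT f0 f1).
Proof.
move=> [m m0 fm] [n n0 fn]; exists (m * n)%N; rewrite ?muln_gt0 ?m0 //.
by rewrite pairX expgnA fm expg1n mulnC expgnA fn expg1n pair1.
Qed.

(** * The four-group generated by b and c *)

Lemma gri_aa : gri_a * gri_a = 1.
Proof. by rewrite -{2}gri_aV mulgV. Qed.
Lemma gri_bb : gri_b * gri_b = 1.
Proof. by rewrite -{2}gri_bV mulgV. Qed.
Lemma gri_cc : gri_c * gri_c = 1.
Proof. by rewrite -{2}gri_cV mulgV. Qed.

Lemma gri_mul : [/\ gri_b * gri_c = gri_d, gri_c * gri_d = gri_b
  & gri_d * gri_b = gri_c].
Proof.
suff fE u : [/\ b_fun (c_fun u) = d_fun u, c_fun (d_fun u) = b_fun u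
  & d_fun (b_fun u) = c_fun u].
  by split; apply: autTP => u; rewrite autTM; case: (fE u).
by elim: u => [//|[] u [Eb Ec Ed]] /=; rewrite ?a_funK ?Eb ?Ec ?Ed.
Qed.

Lemma gri_cb : gri_c * gri_b = gri_b * gri_c.
Proof.
have [bc _ db] := gri_mul.
by rewrite bc -[RHS]mulg1 -gri_bb mulgA db.
Qed.

(** The four-group {1, b, c, d}, indexed so that its law is the componentwise
    exclusive or: (true, true) stands for d = bc. *)
Definition klein (x : bool * bool) : autT := gri_b ^+ x.1 * gri_c ^+ x.2.

Lemma klein0 : klein (false, false) = 1.
Proof. exact: mulg1. Qed.

Lemma kleinM x y : klein x * klein y = klein (x.1 (+) y.1, x.2 (+) y.2).
Proof.
have xb (g : autT) (p q : bool) : g * g = 1 -> g ^+ p * g ^+ q = g ^+ (p (+) q).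
  by case: p q => [] [] /=; rewrite ?expg1 ?expg0 ?mulg1 ?mul1g.
rewrite /klein /= -!mulgA [gri_c ^+ _ * (_ * _)]mulgA.
rewrite (commuteX2 _ _ gri_cb) -mulgA (xb gri_c) ?gri_cc //.
by rewrite mulgA xb ?gri_bb.
Qed.

(** The recursion b = (a, c), c = (a, d), d = (1, b) is linear in the indices:
    on the left subtree stands the power of a with exponent p (+) q, on the
    right subtree the element of index (q, p (+) q); see [klein_pair]. *)
Definition has_a (x : bool * bool) : bool := x.1 (+) x.2.
Definition descend (x : bool * bool) : bool * bool := (x.2, has_a x).

Lemma klein_pair x : klein x = pair_autT (gri_a ^+ has_a x) (klein (descend x)).
Proof.
have [bc _ _] := gri_mul.
have v11 : klein (true, true) = gri_d by exact: bc.
have v10 : klein (true, false) = gri_b by exact: mulg1.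
have v01 : klein (false, true) = gri_c by exact: mul1g.
case: x => [] [] []; rewrite /descend /has_a /= ?v11 ?v10 ?v01 ?klein0.
- exact: gri_dE.
- exact: gri_bE.
- exact: gri_cE.
- exact/esym/pair1.
Qed.

(** * Products of syllables and their sections *)

Fixpoint sylprod (xs : seq (bool * bool)) : autT :=
  if xs is x :: xs' then gri_a * klein x * sylprod xs' else 1.

Lemma sylprod_cat xs ys : sylprod (xs ++ ys) = sylprod xs * sylprod ys.
Proof. by elim: xs => [|x xs IH] /=; rewrite ?mul1g // IH mulgA. Qed.

(** Since a exchanges the two subtrees, the syllables of a product contribute
    to a given subtree alternately through their right part and their left part;
    [e] tells that the first syllable contributes its right part. *)
Fixpoint sect (e : bool) (xs : seq (bool * bool)) : autT :=
  if xs is x :: xs' then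
    (if e then klein (descend x) else gri_a ^+ has_a x) * sect (~~ e) xs'
  else 1.

Lemma sylprod_sect xs : sylprod xs = gri_a ^+ odd (size xs) *
  pair_autT (sect (~~ odd (size xs)) xs) (sect (odd (size xs)) xs).
Proof.
elim: xs => [|x xs IH] /=; first by rewrite mul1g pair1.
rewrite IH klein_pair; case: (odd _) => /=; rewrite ?expg1 ?expg0 ?mul1g.
  by rewrite !mulgA -(mulgA gri_a) pair_a mulgA gri_aa mul1g pairM.
by rewrite -mulgA pairM.
Qed.

(** The number of letters a in the expression defining [sect e xs]. *)
Fixpoint count_a (e : bool) (xs : seq (bool * bool)) : nat :=
  if xs is x :: xs' then ((~~ e && has_a x) + count_a (~~ e) xs')%N else 0%N.

Lemma count_a_cat e xs ys :
  count_a e (xs ++ ys) = (count_a e xs + count_a (e (+) odd (size xs)) ys)%N.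
Proof.
elim: xs e => [|x xs IH] e /=; first by rewrite addbF.
by rewrite IH addNb addbN addnA.
Qed.

(** For [xs] of odd length, both sections of the square of [sylprod xs] have
    this total as their number of letters a: over two turns every syllable
    contributes once with either part. *)
Lemma count_a_both e xs : (count_a e xs + count_a (~~ e) xs)%N = count has_a xs.
Proof.
elim: xs e => [|x xs IH] [] //=; rewrite add0n -(IH true) /=.
  by rewrite addnCA [(count_a false _ + _)%N]addnC.
by rewrite addnA.
Qed.

Lemma count_a_size e xs : (count_a e xs <= size xs)%N.
Proof.
by elim: xs e => [|x xs IH] e //=; rewrite -add1n leq_add ?leq_b1.
Qed.

Lemma count_a_lt e xs : (1 < size xs)%N -> (count_a e xs < size xs)%N.
Proof.
case: xs => [|x [|y xs]] //= _; have := count_a_size e xs.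
by case: e => /=; rewrite ?add0n ?addnA ?addn0 ltnS => H;
  rewrite (leq_trans (leq_add (leq_b1 _) H)).
Qed.

(** [n] is an upper bound for the number of letters a that [g] needs, not
    the least one: an entry of [xs] may be trivial. *)
Definition syllabic n (g : autT) : Prop :=
  exists x xs, size xs = n /\ g = klein x * sylprod xs.

Lemma syllabic1 : syllabic 0 1.
Proof. by exists (false, false), [::]; rewrite klein0 mulg1. Qed.

Lemma syllabic_klein n y g : syllabic n g -> syllabic n (klein y * g).
Proof.
by move=> [x [xs [<- ->]]]; rewrite mulgA kleinM; do 2!eexists.
Qed.

Lemma syllabic_a n g : syllabic n g -> syllabic n.+1 (gri_a * g).
Proof.
move=> [x [xs [<- ->]]]; exists (false, false), (x :: xs).
by rewrite klein0 mul1g /= mulgA.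
Qed.

Lemma syllabic_sect e xs : syllabic (count_a e xs) (sect e xs).
Proof.
elim: xs e => [|x xs IH] e /=; first exact: syllabic1.
case: e => /=; first exact/syllabic_klein/IH.
by case: (has_a x); rewrite ?mul1g; [apply: syllabic_a; exact: IH | exact: IH].
Qed.

(** The right parts that occur in [sect e xs]. When every left part is a,
    these determine the section, which is then again a product of syllables up
    to conjugation by a ([sect_select]). *)
Fixpoint select (e : bool) (xs : seq (bool * bool)) : seq (bool * bool) :=
  if xs is x :: xs' then
    if e then descend x :: select (~~ e) xs' else select (~~ e) xs'
  else [::].

Lemma select_cat e xs ys :
  select e (xs ++ ys) = select e xs ++ select (e (+) odd (size xs)) ys.
Proof.
elim: xs e => [|x xs IH] e /=; first by rewrite addbF.
by rewrite IH addNb addbN; case: e.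
Qed.

Lemma perm_select e xs : perm_eq (select e xs ++ select (~~ e) xs) (map descend xs).
Proof.
elim: xs e => [|x xs IH] [] //=; first by rewrite perm_cons IH.
by rewrite -cat1s perm_catCA /= perm_cons IH.
Qed.

Lemma sect_select (e : bool) xs : all has_a xs ->
  gri_a ^+ e * sect e xs = sylprod (select e xs) * gri_a ^+ (e (+) odd (size xs)).
Proof.
elim: xs e => [|x xs IH] e /=; first by rewrite addbF mulg1 mul1g.
case/andP=> ax /(IH (~~ e)); rewrite addNb addbN; case: e => /= E.
  by rewrite !mulgA -[RHS]mulgA -E mul1g.
by rewrite mul1g ax.
Qed.

(** The square of [sylprod xs] is a pair of sections, each conjugate to a product
    of syllables as long as [xs]. In such a section every entry of [xs] is
    selected exactly once, on the first or on the second turn. *)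
Lemma torsion_odd xs : odd (size xs) -> all has_a xs ->
  (forall ys, perm_eq ys (map descend xs) -> torsion (sylprod ys)) ->
  torsion (sylprod xs).
Proof.
move=> oxs axs tor; apply: (@torsionX _ _ 2) => //.
rewrite expg2 -sylprod_cat sylprod_sect size_cat addnn odd_double mul1g.
have tors e : torsion (sect e (xs ++ xs)).
  have -> : sect e (xs ++ xs) = sylprod (select e (xs ++ xs)) ^ (gri_a ^+ e).
    have := @sect_select e (xs ++ xs).
    rewrite all_cat axs size_cat addnn odd_double addbF => /(_ isT) E.
    by rewrite conjgE -E mulKg.
  apply/torsionJ/tor; rewrite select_cat oxs addbT; exact: perm_select.
by apply: torsion_pair.
Qed.

(** Conjugation moves the leading element of the four-group to the end, where
    it is absorbed by the last syllable. *)
Lemma torsion_syllabic n g :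
  (forall ys, size ys = n -> torsion (sylprod ys)) -> syllabic n g -> torsion g.
Proof.
move=> tor [x [ys [sys ->]]]; elim/last_ind: ys sys => [|ys y _] sys.
  by rewrite mulg1; exists 2 => //; rewrite expg2 kleinM !addbb; exact: klein0.
apply: torsionC.
have -> : sylprod (rcons ys y) * klein x =
    sylprod (rcons ys (y.1 (+) x.1, y.2 (+) x.2)).
  rewrite -!cats1 !sylprod_cat -mulgA.
  by congr (_ * _); rewrite /= mulg1 -mulgA kleinM mulg1.
by apply: tor; move: sys; rewrite !size_rcons.
Qed.

(** * The Grigorchuk group is a torsion group *)

Lemma torsion_sylprod xs : torsion (sylprod xs).
Proof.
have [m] := ubnP (size xs); elim: m xs => // m IHm xs; rewrite ltnS => lem.
have [/size0nil -> | m0] := posnP (size xs); first exact: torsion1.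
have IHsyl n g : (n < m)%N -> syllabic n g -> torsion g.
  by move=> ltn; apply: torsion_syllabic => ys sys; apply: IHm; rewrite sys.
have [lt_m | /(conj lem)/andP] := ltnP (size xs) m; first exact: IHm.
rewrite -eqn_leq => /eqP sxs.
have even_len ys : size ys = m -> ~~ odd m -> torsion (sylprod ys).
  move=> sys ev; rewrite sylprod_sect sys (negbTE ev) mul1g.
  have lt1m : (1 < size ys)%N.
    by rewrite sys; case: (m) ev m0 sxs => [|[]] // _; rewrite lt0n => /eqP.
  by apply: torsion_pair; apply: (IHsyl _ _ _ (syllabic_sect _ _)); rewrite -sys count_a_lt.
(* One of 1 and d occurs in [ys]: the sections of the square are shorter. *)
have in_1d ys : size ys = m -> ~~ all has_a ys -> torsion (sylprod ys).
  move=> sys nal; have [om | /even_len] := boolP (odd m); last exact.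
  apply: (@torsionX _ _ 2) => //.
  rewrite expg2 -sylprod_cat sylprod_sect size_cat addnn odd_double mul1g.
  have tors e : torsion (sect e (ys ++ ys)).
    apply: (IHsyl _ _ _ (syllabic_sect _ _)).
    rewrite count_a_cat sys om addbT count_a_both -sys ltn_neqAle count_size andbT.
    by rewrite -all_count.
  exact: torsion_pair.
(* [(false, true)] is c, whose right part is d. *)
have in_c ys : size ys = m -> (false, true) \in ys -> torsion (sylprod ys).
  move=> sys cys; have [om | /even_len] := boolP (odd m); last exact.
  have [ays | /in_1d] := boolP (all has_a ys); last exact.
  apply: torsion_odd; rewrite ?sys // => zs pzs; apply: in_1d.
    by rewrite (perm_size pzs) size_map.
  apply/allPn; exists (descend (false, true)) => //.
  by rewrite (perm_mem pzs) map_f.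
have [om | /even_len] := boolP (odd m); last exact.
have [axs | /in_1d] := boolP (all has_a xs); last exact.
have [|nc] := boolP ((false, true) \in xs); first exact: in_c.
apply: torsion_odd; rewrite ?sxs // => zs pzs; apply: in_c.
  by rewrite (perm_size pzs) size_map.
(* All entries are b, whose right part is c. *)
have [x xxs] : exists x, x \in xs.
  by case: (xs) m0 => // x xs' _; exists x; exact: mem_head.
rewrite (perm_mem pzs); have := map_f descend xxs.
have := allP axs _ xxs; case: x xxs => [] [] [] // xxs _.
by rewrite xxs in nc.
Qed.

Definition finite_syllabic (g : autT) : Prop := exists n, syllabic n g.

(** Stability under left multiplication by [g^-1] as well as by [g] makes this
    visibly a subgroup, so that only the generators have to be checked. *)
Definition syl_stable : {pred autT} := fun g =>
  `[< forall h, finite_syllabic h ->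
        finite_syllabic (g * h) /\ finite_syllabic (g^-1 * h) >].

Fact syl_stable_mul : mulg_closed syl_stable.
Proof.
move=> f g /asboolP fS /asboolP gS; apply/asboolP => h hS.
rewrite invgM -!mulgA; split; first exact/(fS _ _).1/(gS _ _).1.
exact/(gS _ _).2/(fS _ _).2.
Qed.
Fact syl_stable_one : 1 \in syl_stable.
Proof. by apply/asboolP => h hS; rewrite invg1 mul1g. Qed.
Fact syl_stable_inv : invg_closed syl_stable.
Proof.
by move=> g /asboolP gS; apply/asboolP => h /gS[gh gVh]; rewrite invgK.
Qed.
HB.instance Definition _ := isMulClosed.Build _ syl_stable syl_stable_mul.
HB.instance Definition _ := isMul1Closed.Build _ syl_stable syl_stable_one.
HB.instance Definition _ := isInvClosed.Build _ syl_stable syl_stable_inv.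

Lemma grigorchuk_syllabic (g : grigorchuk) : finite_syllabic (val g).
Proof.
have genS s : grigorchuk_gens s -> s \in syl_stable.
  have kleinS x h : finite_syllabic h -> finite_syllabic (klein x * h).
    by case=> n hn; exists n; exact: syllabic_klein.
  have v10 : klein (true, false) = gri_b by exact: mulg1.
  have v01 : klein (false, true) = gri_c by exact: mul1g.
  by case=> [[]|] ->; apply/asboolP => h hS;
    rewrite ?gri_aV ?gri_bV ?gri_cV -?v10 -?v01; split; try exact: kleinS;
    case: hS => n hn; exists n.+1; exact: syllabic_a.
have /generatedP/(_ _ genS)/asboolP/(_ 1) := valP g.
by rewrite mulg1 => -[|//]; exists 0%N; exact: syllabic1.
Qed.

Lemma grigorchuk_torsion (g : grigorchuk) : torsion g.
Proof.
have [n gn] := grigorchuk_syllabic g.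
have [m m0 gm] := torsion_syllabic (fun ys _ => torsion_sylprod ys) gn.
exists m => //; apply: val_inj; rewrite subgroup_val1 -gm.
by elim: m {m0 gm} => [|m IH]; rewrite ?subgroup_val1 // !expgS subgroup_valM IH.
Qed.

(** * Words in the generators *)

(** [None] is a, [Some true] is b and [Some false] is c, so that negation
    exchanges b and c. *)
Definition letter_autT (o : option bool) : autT :=
  match o with None => gri_a | Some true => gri_b | Some false => gri_c end.

Definition letter_fun (o : option bool) : seq bool -> seq bool :=
  match o with None => a_fun | Some true => b_fun | Some false => c_fun end.

Fact letter_gens o : grigorchuk_gens (letter_autT o).
Proof. by case: o => [[]|]; [left; right | right | left; left]. Qed.

Definition letter (o : option bool) : grigorchuk :=
  Sub (letter_autT o) (mem_generated (letter_gens o)).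

Lemma val_letter o : val (letter o) = letter_autT o.
Proof. by []. Qed.

Lemma letter_gen o : grigorchuk_gens_sub (letter o).
Proof. exact: letter_gens. Qed.

Lemma gen_letter s : grigorchuk_gens_sub s -> exists o, s = letter o.
Proof.
by case=> [[]|] sE; [exists None | exists (Some true) | exists (Some false)];
  apply: val_inj.
Qed.

Definition word (w : seq (option bool)) : grigorchuk :=
  foldr (fun o g => letter o * g) 1 w.

Lemma word_act w u : autT_fun (val (word w)) u = foldr letter_fun u w.
Proof.
elim: w => [|o w IH]; first exact: autT1.
have -> : word (o :: w) = letter o * word w by [].
by rewrite subgroup_valM autTM IH val_letter; case: o => [[]|].
Qed.

Lemma word1P w : word w = 1 <-> forall u, foldr letter_fun u w = u.
Proof.
split=> [w1 u | w1]; first by rewrite -word_act w1 subgroup_val1 autT1.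
by apply/val_inj/autTP => u; rewrite word_act subgroup_val1 autT1 w1.
Qed.

Definition strings n : seq (seq bool) :=
  iter n (fun us => map (cons false) us ++ map (cons true) us) [:: [::]].

Lemma mem_strings n u : size u = n -> u \in strings n.
Proof.
elim: n u => [|n IH] [|x u] //= [/IH un].
by rewrite mem_cat; apply/orP; case: x; [right | left]; exact: map_f.
Qed.

(** A test by computation that a word is not trivial: it moves a string of
    length 5. This depth suffices for all the words considered below. *)
Definition moved (w : seq (option bool)) : bool :=
  has (fun u => foldr letter_fun u w != u) (strings 5).

Lemma moved_neq1 w : moved w -> word w <> 1.
Proof. by case/hasP=> u _ /eqP uw /word1P/(_ u). Qed.

Lemma word_bcbc x : word [:: Some x; Some (~~ x); Some x; Some (~~ x)] = 1.
Proof.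
have bcbc u : c_fun (b_fun (c_fun (b_fun u))) = u.
  have /(congr1 (fun g => autT_fun g (c_fun (b_fun u)))) := gri_cb.
  by rewrite !autTM /autT_fun /= c_funK b_funK.
apply/word1P => u; case: x => /=; last exact: bcbc.
by apply: (inv_inj c_funK); exact: bcbc.
Qed.

Definition alternating (ys : seq bool) : seq (option bool) :=
  flatten [seq [:: Some y; None] | y <- ys].

Lemma word_ca8 : word (alternating (nseq 8 false)) = 1.
Proof.
(* Below the third level the sections of (ca)^8 cancel by a^2 = b^2 = 1 and
   c^2 = d^2 = 1. *)
by apply/word1P; case=> [|[] [|[] [|[] u]]] //=;
  rewrite ?a_funK ?b_funK ?c_funK ?d_funK.
Qed.

(** No closed non-backtracking walk of length 4 starts along an a-edge. *)
Lemma moved_a x y z : x != None -> x != y -> y != z -> moved [:: None; x; y; z].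
Proof. by case: x y z => [[]|] [[]|] [[]|] //; vm_compute. Qed.

Lemma moved_alternating ys : size ys = 7 -> moved (alternating (true :: ys)).
Proof. by move/mem_strings; apply/allP: ys; vm_compute. Qed.

(** * Rigidity of the Cayley graph *)

Definition edge_map (phi : grigorchuk -> grigorchuk) : Prop :=
  forall v o, exists o', phi (v * letter o) = phi v * letter o'.

Lemma letterK o : letter o * letter o = 1.
Proof.
suff : word [:: o; o] = 1 by rewrite /= mulg1.
apply/word1P => u.
by case: o => [[]|] /=; rewrite ?a_funK ?b_funK ?c_funK.
Qed.

Lemma letter_neq o o' : o != o' -> letter o * letter o' <> 1.
Proof.
move=> neq; suff /moved_neq1 : moved [:: o; o'] by rewrite /= mulg1.
by case: o o' neq => [[]|] [[]|] //; vm_compute.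
Qed.

Lemma letter_inj : injective letter.
Proof.
move=> o o' E; apply/eqP/negPn/negP => /letter_neq; rewrite E.
by apply; exact: letterK.
Qed.

Section EdgeMap.
Variables (phi : grigorchuk -> grigorchuk).
Hypotheses (phi_inj : injective phi) (phiE : edge_map phi).

(** An injective map that sends edges to edges sends non-backtracking walks to
    non-backtracking walks. *)
Lemma edge_map_step v o o' w : phi (v * letter o) = phi v * letter o' ->
  o != w -> exists2 w', o' != w' &
    phi (v * letter o * letter w) = phi v * letter o' * letter w'.
Proof.
move=> E neq; have [w' E'] := phiE (v * letter o) w; exists w'; last by rewrite E' E.
apply/eqP => ow; move: E'; rewrite E -ow -[RHS]mulgA letterK mulg1 => /phi_inj.
rewrite -mulgA -[RHS]mulg1 => /mulgI; exact: letter_neq.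
Qed.

(** The 4-cycle (bc)^2 or (cb)^2 through the edge would otherwise be sent to
    a closed non-backtracking walk excluded by [moved_a]. *)
Lemma edge_map_neqa v x : phi (v * letter (Some x)) <> phi v * letter None.
Proof.
move=> E.
have [|o2 n2 E2] := edge_map_step E (w := Some (~~ x)); first by case: (x).
rewrite -E in E2.
have [|o3 n3 E3] := edge_map_step E2 (w := Some x); first by case: (x).
rewrite -E2 in E3.
have [|o4 n4 E4] := edge_map_step E3 (w := Some (~~ x)); first by case: (x).
have sq : v * letter (Some x) * letter (Some (~~ x)) * letter (Some x)
    * letter (Some (~~ x)) = v.
  by rewrite -[RHS]mulg1 -(word_bcbc x) /= mulg1 !mulgA.
have /moved_neq1 : moved [:: None; o2; o3; o4].
  by apply: moved_a => //; rewrite eq_sym.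
apply; move: E4; rewrite E2 E sq -[LHS]mulg1 -!mulgA => /mulgI ->.
by rewrite /= mulg1.
Qed.

(** The edges labelled b and c cannot be sent to the a-edge, so by injectivity
    they occupy both of the remaining edges. *)
Lemma edge_map_a v : phi (v * letter None) = phi v * letter None.
Proof.
have [[x|] Ea] := phiE v None; last exact: Ea.
have other y : phi (v * letter (Some y)) = phi v * letter (Some (~~ x)).
  have [[z|] Ez] := phiE v (Some y); last by case: (edge_map_neqa Ez).
  have [<- // | /negPf zx] := eqVneq z (~~ x).
  have {}zx : z = x by case: (z) (x) zx => [] [].
  by move: Ez; rewrite zx -Ea => /phi_inj/mulgI/letter_inj.
by have := other true; rewrite -(other false) => /phi_inj/mulgI/letter_inj.
Qed.

Lemma edge_map_bc v x :
  exists y, phi (v * letter (Some x)) = phi v * letter (Some y).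
Proof.
by have [[y|] E] := phiE v (Some x); [exists y | case: (edge_map_neqa E)].
Qed.

Lemma edge_map_alternating v xs : exists2 ys, size ys = size xs &
  phi (v * word (alternating xs)) = phi v * word (alternating ys).
Proof.
elim: xs v => [|x xs IH] v; first by exists [::]; rewrite ?mulg1.
have [y Ey] := edge_map_bc v x.
have [ys sys Eys] := IH (v * letter (Some x) * letter None).
exists (y :: ys); first by rewrite /= sys.
by rewrite !mulgA Eys edge_map_a Ey -!mulgA.
Qed.

(** If the label c became b at [v], the closed walk (ca)^8 from [v] would be
    sent to a closed walk along a word excluded by [moved_alternating]. *)
Lemma edge_map_c v : phi (v * letter (Some false)) = phi v * letter (Some false).
Proof.
have [[] Ec] := edge_map_bc v false; last exact: Ec.
have [ys sys Eys] :=
  edge_map_alternating (v * letter (Some false) * letter None) (nseq 7 false).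
have /moved_neq1 [] := moved_alternating sys.
apply: (@mulgI _ (phi v)); rewrite mulg1.
have -> : word (alternating (true :: ys)) =
  letter (Some true) * (letter None * word (alternating ys)) by [].
rewrite !mulgA -Ec -edge_map_a -Eys -!mulgA.
rewrite -[X in v * X]/(word (alternating (nseq 8 false))).
by rewrite word_ca8 mulg1.
Qed.

Lemma edge_map_letter v o : phi (v * letter o) = phi v * letter o.
Proof.
case: o => [[]|]; [|exact: edge_map_c|exact: edge_map_a].
have [[] // E] := edge_map_bc v true.
by move: E; rewrite -edge_map_c => /phi_inj/mulgI/letter_inj.
Qed.

Definition right_equivariant : {pred grigorchuk} :=
  fun w => `[< forall v, phi (v * w) = phi v * w >].

Fact right_equivariant_mul : mulg_closed right_equivariant.
Proof.
move=> x y /asboolP xE /asboolP yE; apply/asboolP => v.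
by rewrite mulgA yE xE mulgA.
Qed.
Fact right_equivariant_one : 1 \in right_equivariant.
Proof. by apply/asboolP => v; rewrite !mulg1. Qed.
Fact right_equivariant_inv : invg_closed right_equivariant.
Proof.
move=> x /asboolP xE; apply/asboolP => v.
by apply: (@mulIg _ x); rewrite -xE !mulgVK.
Qed.
HB.instance Definition _ :=
  isMulClosed.Build _ right_equivariant right_equivariant_mul.
HB.instance Definition _ :=
  isMul1Closed.Build _ right_equivariant right_equivariant_one.
HB.instance Definition _ :=
  isInvClosed.Build _ right_equivariant right_equivariant_inv.

Lemma edge_map_translation v : phi v = phi 1 * v.
Proof.
have genE s : grigorchuk_gens_sub s -> s \in right_equivariant.
  by case/gen_letter=> o ->; apply/asboolP => w; exact: edge_map_letter.
have /generatedP/(_ _ genE)/asboolP/(_ 1) := grigorchuk_gens_generate v.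
by rewrite mul1g.
Qed.

End EdgeMap.

(** * Difference-invariant functions *)

Lemma grigorchuk_autE (f : gaut grigorchuk_graph) (v : grigorchuk) :
  f v = (f (1 : grigorchuk) : grigorchuk) * v :> grigorchuk.
Proof.
apply: (@edge_map_translation (f : grigorchuk -> grigorchuk)).
  exact: (bij_inj (gaut_bij f)).
move=> {}v o; have : @adj grigorchuk_graph v (v * letter o).
  by exists (letter o) => //; exact: letter_gen.
by move/(gaut_adj f) => [s /gen_letter[o' ->] E]; exists o'.
Qed.

Lemma grigorchuk_aut_iter (f : gaut grigorchuk_graph) (v : grigorchuk) n :
  iter n f v = (f (1 : grigorchuk) : grigorchuk) ^+ n * v :> grigorchuk.
Proof.
elim: n => [|n IH]; first by rewrite mul1g.
by rewrite iterS IH [LHS]grigorchuk_autE expgS mulgA.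
Qed.

Lemma grigorchuk_aut_periodic (f : gaut grigorchuk_graph) :
  exists2 n, (0 < n)%N & iter n f =1 id.
Proof.
have [n n0 fn] := grigorchuk_torsion (f (1 : grigorchuk)).
by exists n => // v; rewrite [LHS]grigorchuk_aut_iter fn mul1g.
Qed.

Lemma difference_invariant_orbit (W : numDomainType)
    (H : groupClosed (gaut grigorchuk_graph)) (F : grigorchuk_graph -> W) f v :
  difference_invariant H F -> f \in H -> F (f v) = F v.
Proof.
move=> FH fH; have [n n0 fn] := grigorchuk_aut_periodic f.
have Fn k : (F (iter k f v) - F v = (F (f v) - F v) *+ k)%R.
  elim: k => [|k IH]; first by rewrite subrr.
  rewrite mulrS -IH iterS.
  by rewrite [RHS]addrC (FH f (iter k f v) v fH) addrA subrK.
have /eqP := Fn n; rewrite fn subrr eq_sym mulrn_eq0 eqn0Ngt n0 /=.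
by rewrite subr_eq0 => /eqP.
Qed.

(** * Functions with finitely many values *)

Lemma seq_max (x0 : int) s :
  exists2 M, M \in x0 :: s & forall x, x \in x0 :: s -> (x <= M)%R.
Proof.
elim: s x0 => [|y s IH] x0; first by exists x0 => [|x]; rewrite inE // => /eqP->.
have [M Ms maxM] := IH (Order.max x0 y); exists M.
  by move: Ms; rewrite !inE maxEle; case: ifP => _ /orP[->|->]; rewrite ?orbT.
have /andP[x0M yM] : (x0 <= M)%R && (y <= M)%R.
  by rewrite -ge_max; apply: maxM; exact: mem_head.
move=> x; rewrite !inE => /or3P[/eqP->|/eqP->|xs] //.
by apply: maxM; rewrite inE xs orbT.
Qed.

Lemma finite_set_max (A : set int) : finite_set A -> A !=set0 ->
  exists2 M, A M & forall x, A x -> (x <= M)%R.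
Proof.
move=> /finite_seqP[[|x0 s] -> [x //= xs]].
exact: seq_max.
Qed.

Theorem theorem5p1 :
  (~ exists (h : grigorchuk_graph -> int)
            (H : groupClosed (gaut grigorchuk_graph)),
       graph_height_function (cayley_id grigorchuk_cayley_set) h H)
  /\
  (forall (R : realType) (H : groupClosed (gaut grigorchuk_graph))
          (F : grigorchuk_graph -> R),
     normal_subgroup H -> finite_index H -> difference_invariant H F ->
     forall v x y : grigorchuk_graph, aut_orbit H v x -> aut_orbit H v y -> F x = F y).
Proof.
split=> [[h [H [Hqt h0 hH hup]]] | R H F _ _ FH v x y [f fH ->] [g gH ->]]; last first.
  by rewrite !(difference_invariant_orbit _ FH).
have orbE v w : aut_orbit H v w -> h w = h v.
  by case=> f fH ->; exact: difference_invariant_orbit hH fH.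
(* [h] factors through the set of orbits. *)
pose rep (O : set grigorchuk) : int := h (xget (1 : grigorchuk) O).
have fin : finite_set (range h).
  apply: (@sub_finite_set _ _ (rep @` range (@aut_orbit _ H)));
    last exact: finite_image.
  move=> _ [v _ <-]; exists (aut_orbit H v); first by exists v.
  apply: orbE; apply: (@xgetPex grigorchuk).
  by exists v; exists 1 => //; exact: gpred1.
have [|M [v _ <-] maxh] := finite_set_max fin.
  by exists (h (1 : grigorchuk)); exact: imageP.
have [u [w [_ _ /andP[_ vw]]]] := hup v.
by have := lt_le_trans vw (maxh _ (imageP h I)); rewrite ltxx.
Qed.
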